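(* Let $0<\alpha<2$, let $N\ge1$ be an integer, and let $x_0,\dots,x_{N-1}\in\mathbb{R}$ be the roots of the Hermite polynomial $H_N$. Define real numbers $a_{n,k}$ (integers $n,k\ge0$) by $a_{n,k}=0$ for $k>n$, $a_{0,0}=1$, $a_{1,0}=0$, $a_{1,1}=2$, and for $n\ge1$, $$a_{n+1,0}=-a_{n,1},\qquad a_{n+1,k}=2a_{n,k-1}-(k+1)a_{n,k+1}\quad (k>0),$$ and set $\hat a_{n,k}=\frac{1}{\sqrt{2^n n!}}\,a_{n,k}$. For each integer $k\ge 0$ define $F_k:\mathbb{R}\to\mathbb{C}$ by $$F_{2m}(x)=\frac{2^{\frac{2m+\alpha}{2}}}{\sqrt{\pi}}\,\Gamma\left(\frac{2m+1+\alpha}{2}\right){}_1F_1\left(\frac{2m+1+\alpha}{2},\frac12;-\frac{x^2}{2}\right),$$ $$F_{2m+1}(x)=\frac{2^{\frac{2m+2+\alpha}{2}}\,\mathrm{i}}{\sqrt{\pi}}\,\Gamma\left(\frac{2m+3+\alpha}{2}\right)x\;{}_1F_1\left(\frac{2m+3+\alpha}{2},\frac32;-\frac{x^2}{2}\right)$$ for integers $m\ge0$. Then for all integers $0\le n,m\le N-1$, $$(-\Delta)^{\alpha/2}\widehat{H}_n(x_m)=(-\mathrm{i})^n\sum_{k=0}^{N-1}\hat a_{n,k}\,F_k(x_m).$$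
   Context: The Hermite polynomials are defined by $H_0(x)=1$, $H_1(x)=2x$, $H_{n+1}(x)=2xH_n(x)-2nH_{n-1}(x)$ for $n\ge1$. The normalized Hermite functions are $$\widehat{H}_n(x)=\frac{1}{\sqrt{2^n n!}}\,e^{-x^2/2}H_n(x),\qquad x\in\mathbb{R}.$$ The confluent hypergeometric function is ${}_1F_1(a,b;x)=\sum_{k=0}^\infty \frac{(a)_k}{(b)_k}\frac{x^k}{k!}$, where $(a)_0=1$ and $(a)_k=a(a+1)\cdots(a+k-1)$. Here $\mathrm{i}=\sqrt{-1}$. The fractional Laplacian on $\mathbb{R}$ is defined via the Fourier transform by $\mathcal{F}[(-\Delta)^{\alpha/2}u](\xi)=|\xi|^\alpha\,\mathcal{F}[u](\xi)$, where $\mathcal{F}[u](\xi)=\frac{1}{\sqrt{2\pi}}\int_{\mathbb{R}}u(x)e^{-\mathrm{i}x\xi}\,dx$; that is, $(-\Delta)^{\alpha/2}u(x)=\frac{1}{\sqrt{2\pi}}\int_{\mathbb{R}}|\xi|^\alpha\mathcal{F}[u](\xi)e^{\mathrm{i}x\xi}\,d\xi$. *)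

(* Defs.v *)
From HB Require Import structures.
From mathcomp Require Import all_boot all_order all_algebra.
From mathcomp Require Import all_classical all_reals all_analysis.
From mathcomp Require Import complex.

Set Implicit Arguments.
Unset Strict Implicit.
Unset Printing Implicit Defensive.

Import Order.TTheory GRing.Theory Num.Theory.
Import numFieldNormedType.Exports.

Local Open Scope classical_set_scope.
Local Open Scope ring_scope.
Local Open Scope complex_scope.

Section Hermite.
Variable R : realType.

Fixpoint hermite (n : nat) : {poly R} :=
  match n with
  | 0 => 1
  | m.+1 => match m with
            | 0 => 2 *: 'X
            | l.+1 => 2 *: ('X * hermite m) - (2 * m%:R) *: hermite l
            end
  end.

Definition hermite_fun (n : nat) (x : R) : R :=
  (Num.sqrt (2 ^+ n * n`!%:R))^-1 * expR (- x ^+ 2 / 2) * (hermite n).[x].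

Fixpoint acoef (n k : nat) : R :=
  if (n < k)%N then 0 else
  match n, k with
  | 0, _ => 1
  | 1, 0 => 0
  | 1, _ => 2
  | (_.+1 as m).+1, 0 => - acoef m 1
  | (_.+1 as m).+1, l.+1 => 2 * acoef m l - k.+1%:R * acoef m k.+1
  end.

Definition acoef_hat (n k : nat) : R :=
  (Num.sqrt (2 ^+ n * n`!%:R))^-1 * acoef n k.

Lemma acoef_gt n k : (n < k)%N -> acoef n k = 0.
Proof. by case: n k => [|n] k /= ->. Qed.

(* For n >= 1 the recurrences hold for every k, including k > n + 1 where the
   value 0 is imposed by definition. *)
Lemma acoefS0 n : (0 < n)%N -> acoef n.+1 0 = - acoef n 1.
Proof. by case: n. Qed.

Lemma acoefSS n k : (0 < n)%N -> (0 < k)%N ->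
  acoef n.+1 k = 2 * acoef n k.-1 - k.+1%:R * acoef n k.+1.
Proof.
case: n k => // n [//|k] _ _; case: (ltnP n.+2 k.+1) => h; last first.
  by rewrite [LHS]/= ltnNge h.
have hk : (n.+1 < k)%N by [].
by rewrite !acoef_gt ?mulr0 ?subr0 //= ltnW // ltnW.
Qed.

End Hermite.

Section SpecialFunctions.
Variable R : realType.

(* Euler's integral; only meaningful for s > 0. *)
Definition Gamma (s : R) : R :=
  \int[@lebesgue_measure R]_(t in `]0, +oo[) (t `^ (s - 1) * expR (- t)).

Definition pochhammer (a : R) (k : nat) : R := \prod_(i < k) (a + i%:R).

Definition hyp1F1 (a b x : R) : R :=
  limn [series pochhammer a k / pochhammer b k * (x ^+ k / k`!%:R)]_k.

End SpecialFunctions.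

Section Fourier.
Variable R : realType.

Definition expi (t : R) : R[i] := cos t +i* sin t.

Definition cintegral (f : R -> R[i]) : R[i] :=
  (\int[@lebesgue_measure R]_(x in [set: R]) complex.Re (f x)) +i*
  (\int[@lebesgue_measure R]_(x in [set: R]) complex.Im (f x)).

Definition fourier (u : R -> R[i]) (xi : R) : R[i] :=
  (Num.sqrt (2 * pi))^-1%:C * cintegral (fun x => u x * expi (- (x * xi))).

(* frac_laplacian alpha is (-Delta)^(alpha/2). *)
Definition frac_laplacian (alpha : R) (u : R -> R[i]) (x : R) : R[i] :=
  (Num.sqrt (2 * pi))^-1%:C *
  cintegral (fun xi => (`|xi| `^ alpha)%:C * fourier u xi * expi (x * xi)).

End Fourier.

Section F.
Variables (R : realType) (alpha : R).

Definition Feven (m : nat) (x : R) : R[i] :=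
  (2 `^ (((2 * m)%:R + alpha) / 2) / Num.sqrt pi
   * Gamma (((2 * m + 1)%:R + alpha) / 2)
   * hyp1F1 (((2 * m + 1)%:R + alpha) / 2) (1 / 2) (- x ^+ 2 / 2))%:C.

Definition Fodd (m : nat) (x : R) : R[i] :=
  'i%C * (2 `^ (((2 * m + 2)%:R + alpha) / 2) / Num.sqrt pi
   * Gamma (((2 * m + 3)%:R + alpha) / 2)
   * x * hyp1F1 (((2 * m + 3)%:R + alpha) / 2) (3 / 2) (- x ^+ 2 / 2))%:C.

Definition Ffun (k : nat) : R -> R[i] :=
  if odd k then Fodd k./2 else Feven k./2.

End F.

(* Main.v *)
Require Import Defs.
From mathcomp Require Import all_boot all_order all_algebra.
From mathcomp Require Import all_classical all_reals all_analysis.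
From mathcomp Require Import complex measurable_realfun ring lra.
Import Order.TTheory GRing.Theory Num.Theory.
Import numFieldNormedType.Exports.
Local Open Scope ring_scope.
Local Open Scope complex_scope.

(** Multiplication by t is turned into differentiation by integrating by parts
    against e^(-t^2/2), and H_(n+1) = 2 X H_n - H_n'; hence the Fourier transform
    of H_n e^(-t^2/2) obeys the Hermite recurrence up to a factor -i, and the
    normalized Hermite functions are eigenvectors for (-i)^n.  The Gaussian is the
    starting point.
    The fractional Laplacian of the n-th Hermite function at y is thus (-i)^n
    times a combination, with the coefficients of H_n, of the integrals of
    |t|^alpha t^k e^(-t^2/2) e^(iyt).  Expanding cos and sin and exchanging sum
    and integral (the partial sums are bounded by e^|yt|), the moments
    of |t|^alpha e^(-t^2/2) appear; the relation M_(k+2) = (alpha+k+1) M_k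
    makes the series hypergeometric, and u = t^2/2 turns the first moment into
    a value of Gamma.  The case alpha = k = 0 is the transform of the Gaussian. *)

Set Implicit Arguments.
Unset Strict Implicit.
Unset Printing Implicit Defensive.

(** * Integration against the Gaussian weight *)

Section GaussianIntegral.
Variable R : realType.
Local Open Scope classical_set_scope.
Local Notation mu := (@lebesgue_measure R).
Implicit Types (f g : R -> R) (t x : R).

Definition gaussian t : R := expR (- t ^+ 2 / 2).

Definition gint f : R := \int[mu]_t (f t * gaussian t).

(** This class is closed under sums and products, contains polynomials, [cos], [sin] and the powers
    |t|^a with a >= 0, and all its members are integrable against the Gaussian. Integrability side
    conditions thus reduce to closure properties. *)
Definition subexp f :=
  continuous f /\ exists C c : R, forall t, `|f t| <= C * expR (c * `|t|).

Lemma subexp_bound_ge0 (f : R -> R) (C c : R) :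
  (forall t, `|f t| <= C * expR (c * `|t|)) -> 0 <= C.
Proof.
by move=> /(_ 0); rewrite normr0 mulr0 expR0 mulr1; exact: le_trans.
Qed.

Lemma subexp_cst (r : R) : subexp (fun=> r).
Proof.
split; first exact: cst_continuous.
by exists `|r|, 0 => t; rewrite mul0r expR0 mulr1.
Qed.

Lemma subexp_id : subexp (fun t => t).
Proof.
split; first by move=> ?; exact: cvg_id.
exists 1, 1 => t; rewrite !mul1r.
by apply: le_trans (expR_ge1Dx _); rewrite lerDr.
Qed.

Lemma subexpD f g : subexp f -> subexp g -> subexp (fun t => f t + g t).
Proof.
move=> [cf [C [c fC]]] [cg [D [d gD]]]; split.
  by move=> t; exact: cvgD (cf t) (cg t).
exists (C + D), (Num.max c d) => t.
rewrite (le_trans (ler_normD _ _))// mulrDl lerD//.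
  apply: le_trans (fC t) _; rewrite ler_wpM2l ?(subexp_bound_ge0 fC)//.
  by rewrite ler_expR ler_wpM2r// le_max lexx.
apply: le_trans (gD t) _; rewrite ler_wpM2l ?(subexp_bound_ge0 gD)//.
by rewrite ler_expR ler_wpM2r// le_max lexx orbT.
Qed.

Lemma subexpM f g : subexp f -> subexp g -> subexp (fun t => f t * g t).
Proof.
move=> [cf [C [c fC]]] [cg [D [d gD]]]; split.
  by move=> t; exact: cvgM (cf t) (cg t).
exists (C * D), (c + d) => t.
by rewrite normrM mulrDl expRD mulrACA ler_pM.
Qed.

Lemma subexpZ (r : R) f : subexp f -> subexp (fun t => r * f t).
Proof. by move=> hf; apply: subexpM => //; exact: subexp_cst. Qed.

Lemma subexpX f n : subexp f -> subexp (fun t => f t ^+ n).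
Proof.
move=> hf; elim: n => [|n ih]; first exact: subexp_cst.
by under eq_fun do rewrite exprS; exact: subexpM.
Qed.

Lemma subexp_sum (I : Type) (s : seq I) (F : I -> R -> R) :
  (forall i, subexp (F i)) -> subexp (fun t => \sum_(i <- s) F i t).
Proof.
move=> hF; elim: s => [|i s ih].
  by under eq_fun do rewrite big_nil; exact: subexp_cst.
by under eq_fun do rewrite big_cons; exact: subexpD.
Qed.

Lemma subexp_horner (p : {poly R}) : subexp (fun t => p.[t]).
Proof.
under eq_fun do rewrite horner_coef.
by apply: subexp_sum => i; apply: subexpZ; apply: subexpX; exact: subexp_id.
Qed.

Lemma bounded_subexp f : continuous f -> (forall t, `|f t| <= 1) -> subexp f.
Proof.
by move=> cf f1; split => //; exists 1, 0 => t; rewrite mul0r expR0 mulr1.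
Qed.

Lemma continuousMl (x : R) : continuous (fun t : R => x * t).
Proof. by move=> t; apply: cvgM; [exact: cvg_cst|exact: cvg_id]. Qed.

Lemma subexp_cos x : subexp (fun t => cos (x * t)).
Proof.
apply: bounded_subexp => [t|t]; last first.
  by rewrite ler_norml cos_geN1 cos_le1.
apply: (@continuous_comp _ _ _ (fun t : R => x * t) (@cos R)).
  exact: continuousMl.
exact: continuous_cos.
Qed.

Lemma subexp_sin x : subexp (fun t => sin (x * t)).
Proof.
apply: bounded_subexp => [t|t]; last first.
  by rewrite ler_norml sin_geN1 sin_le1.
apply: (@continuous_comp _ _ _ (fun t : R => x * t) (@sin R)).
  exact: continuousMl.
exact: continuous_sin.
Qed.

Lemma subexp_expR_norm x : subexp (fun t => expR (x * `|t|)).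
Proof.
split; last by exists 1, x => t; rewrite mul1r ger0_norm// expR_ge0.
move=> t; apply: (@continuous_comp _ _ _ (fun t : R => x * `|t|) (@expR R)).
  2: exact: continuous_expR.
by apply: cvgM; [exact: cvg_cst|exact: norm_continuous].
Qed.

(** Away from 0 this is a composition of continuous maps. At 0 the one-sided limit of u^a is
    transported along u = |t|, the point itself being treated apart. *)
Lemma continuous_powR_norm (a : R) : 0 <= a ->
  continuous (fun t : R => `|t| `^ a).
Proof.
rewrite le_eqVlt => /predU1P[<-|a0].
  by under eq_fun do rewrite powRr0; exact: cst_continuous.
have cpos t : 0 < t -> {for t, continuous (fun t : R => t `^ a)}.
  move=> t0; apply/differentiable_continuous/derivable1_diffP.
  by apply: derivable_powR; rewrite in_itv/= andbT.
move=> t; have [->|t0] := eqVneq t 0.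
  rewrite /continuous_at normr0 powR0 ?gt_eqF//.
  have h := powR_cvg0 a0.
  apply/cvgrPdist_lt => e e0.
  move/cvgrPdist_lt : h => /(_ e e0)[d /= d0 hd].
  near=> u; rewrite sub0r normrN.
  have [->|u0] := eqVneq u 0; first by rewrite normr0 powR0 ?gt_eqF// normr0.
  have ud : `|u| < d by near: u; exists d => //= v; rewrite /ball/= sub0r normrN.
  have /= := hd `|u|; rewrite !sub0r !normrN normr_id => /(_ ud); apply.
  by rewrite normr_gt0.
apply: (@continuous_comp _ _ _ (fun u : R => `|u|) (fun u : R => u `^ a)).
  exact: norm_continuous.
by apply: cpos; rewrite normr_gt0.
Unshelve. all: by end_near. Qed.

Lemma subexp_powR_norm (a : R) : 0 <= a -> subexp (fun t => `|t| `^ a).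
Proof.
move=> a0; split; first exact: continuous_powR_norm.
(* The bound is |t| <= 1 + |t| <= e^|t| raised to the power a. *)
exists 1, a => t; rewrite mul1r mulrC expRM ger0_norm ?powR_ge0//.
apply: ge0_ler_powR; rewrite ?nnegrE ?expR_ge0//.
by apply: le_trans (expR_ge1Dx _); rewrite lerDr.
Qed.

Lemma gaussian_ge0 t : 0 <= gaussian t.
Proof. exact: expR_ge0. Qed.

Lemma gaussianN t : gaussian (- t) = gaussian t.
Proof. by rewrite /gaussian sqrrN. Qed.

Lemma is_derive_gaussian t : is_derive t 1 gaussian (- t * gaussian t).
Proof.
rewrite /gaussian; apply: is_derive_eq.
by rewrite /GRing.scale/=; lra.
Qed.

Lemma continuous_gaussian : continuous gaussian.
Proof.
move=> t; apply/differentiable_continuous/derivable1_diffP.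
by have [] := is_derive_gaussian t.
Qed.

Lemma continuous_subexp_gaussian f : subexp f ->
  continuous (fun t => f t * gaussian t).
Proof. by move=> [cf _] t; exact: cvgM (cf t) (@continuous_gaussian t). Qed.

(** A multiple of the normal density of standard deviation sqrt 2 dominates: (|t|/2 - c)^2 >= 0
    gives c|t| - t^2/2 <= c^2 - t^2/4. *)
Lemma integrable_subexp_gaussian f : subexp f ->
  mu.-integrable setT (EFin \o (fun t => f t * gaussian t)).
Proof.
move=> hf; have [cf [C [c fC]]] := hf.
have C0 := subexp_bound_ge0 fC.
have s0 : Num.sqrt 2 != 0 :> R by rewrite gt_eqF// sqrtr_gt0.
pose K := C * expR (c ^+ 2) / normal_peak (Num.sqrt (2 : R)).
have := integrableZl measurableT K (integrable_normal_pdf (0 : R) (Num.sqrt 2)).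
apply: le_integrable => //.
  apply/measurable_EFinP; apply: continuous_measurable_fun.
  exact: continuous_subexp_gaussian.
move=> t _; rewrite -EFinM /= lee_fin [leRHS]ger0_norm; last first.
  by rewrite !mulr_ge0// ?expR_ge0 ?invr_ge0 ?normal_peak_ge0 ?normal_pdf_ge0.
rewrite /normal_pdf (negbTE s0) /K mulrA divfK ?gt_eqF ?normal_peak_gt0//.
rewrite /normal_fun subr0 sqr_sqrtr// -mulrA -expRD normrM.
rewrite [`|gaussian t|]ger0_norm ?gaussian_ge0//.
apply: le_trans (ler_wpM2r (gaussian_ge0 t) (fC t)) _.
rewrite -mulrA ler_wpM2l// /gaussian -expRD ler_expR -(real_normK (num_real t)).
have := sqr_ge0 (`|t| / 2 - c); lra.
Qed.

Lemma gintD f g : subexp f -> subexp g ->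
  gint (fun t => f t + g t) = gint f + gint g.
Proof.
move=> hf hg; rewrite -RintegralD//; try exact: integrable_subexp_gaussian.
by apply: eq_Rintegral => t _; rewrite mulrDl.
Qed.

Lemma gintZ (r : R) f : subexp f -> gint (fun t => r * f t) = r * gint f.
Proof.
move=> hf; rewrite -RintegralZl//; try exact: integrable_subexp_gaussian.
by apply: eq_Rintegral => t _; rewrite mulrA.
Qed.

Lemma gint0 : gint (fun=> 0) = 0.
Proof.
by rewrite -[RHS](mul0r (gint (fun=> 0))) -gintZ ?mul0r//; exact: subexp_cst.
Qed.

Lemma gint_sum (I : Type) (s : seq I) (F : I -> R -> R) :
  (forall i, subexp (F i)) ->
  gint (fun t => \sum_(i <- s) F i t) = \sum_(i <- s) gint (F i).
Proof.
move=> hF; elim: s => [|i s ih].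
  by rewrite big_nil -[RHS]gint0; congr gint; apply/funext => t; rewrite big_nil.
rewrite big_cons -ih -gintD//; last exact: subexp_sum.
by congr gint; apply/funext => t; rewrite big_cons.
Qed.

(** The standard normal density has total mass 1. *)
Lemma gint1 : gint (fun=> 1) = Num.sqrt (2 * pi).
Proof.
have n1 : (1 : R) != 0 by exact: oner_neq0.
have p0 : Num.sqrt (2 * pi) != 0 :> R.
  by rewrite gt_eqF// sqrtr_gt0 mulr_gt0// pi_gt0.
have : \int[mu]_x normal_pdf (0 : R) 1 x = 1.
  by rewrite /Rintegral integral_normal_pdf.
have -> : normal_pdf (0 : R) 1 = fun t => (Num.sqrt (2 * pi))^-1 * (1 * gaussian t).
  apply/funext => t; rewrite /normal_pdf (negbTE n1) /normal_peak /normal_fun.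
  by rewrite subr0 expr1n !mul1r mulr_natl.
rewrite RintegralZl//; last exact/integrable_subexp_gaussian/subexp_cst.
by rewrite -/(gint _) => /(canRL (mulKf _)) ->; rewrite ?invr_eq0// invrK mulr1.
Qed.

End GaussianIntegral.

(** * Symmetry and integration by parts on the line *)

Section GaussianIntegrationByParts.
Variable R : realType.
Local Open Scope classical_set_scope.
Local Notation mu := (@lebesgue_measure R).
Implicit Types (f g F : R -> R) (t x : R).

(** Dominated convergence: at each point the truncations of F are eventually equal to F. This
    reduces identities on the line to compact intervals, where substitution and the fundamental
    theorem of calculus apply. *)
Lemma cvg_Rintegral_itvNn F : mu.-integrable setT (EFin \o F) ->
  \int[mu]_(t in `[- n%:R, n%:R]) F t @[n --> \oo] --> \int[mu]_t F t.
Proof.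
move=> iF; have mF := measurable_int mu iF.
pose f_ n : R -> \bar R := (EFin \o F) \_ `[- n%:R, n%:R].
have mf_ n : measurable_fun setT (f_ n).
  by apply/(measurable_restrictT _ _).1 => //; exact: measurable_funTS.
have f_F : {ae mu, forall t, setT t -> f_ ^~ t @ \oo --> (EFin \o F) t}.
  apply: aeW => t _; apply: cvg_near_cst; near=> n.
  rewrite /f_ patchE mem_set//= in_itv/= -ler_norml.
  near: n; exact: nbhs_infty_ger.
have f_le : {ae mu, forall t n, setT t -> (`|f_ n t| <= (`|F t|)%:E)%E}.
  apply: aeW => t n _; rewrite /f_ patchE; case: ifPn => _ //.
  by rewrite abse0 lee_fin.
have [_ _] := @dominated_convergence _ _ R mu setT measurableT _ _ _
  mf_ mF f_F (integrable_norm iF) f_le.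
have iFfin : (\int[mu]_t (F t)%:E)%E \is a fin_num by exact: integrable_fin_num.
rewrite -[X in _ --> X]fineK// => /fine_cvg; apply: cvg_trans.
apply: near_eq_cvg; near=> n.
by rewrite /= /Rintegral [in RHS]integral_mkcond.
Unshelve. all: by end_near. Qed.

Lemma Rintegral_oppr F : continuous F -> mu.-integrable setT (EFin \o F) ->
  mu.-integrable setT (EFin \o (F \o -%R)) ->
  \int[mu]_t F (- t) = \int[mu]_t F t.
Proof.
move=> cF iF iFN.
have h1 := cvg_Rintegral_itvNn iF.
have h2 := cvg_Rintegral_itvNn iFN.
apply: (cvg_unique _ h2) => //; apply: cvg_trans h1.
apply: near_eq_cvg; near=> n.
have nn : - n%:R <= n%:R :> R by have := ler0n R n; lra.
rewrite /Rintegral -integration_by_substitution_oppr// ?opprK//.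
exact: continuous_subspaceT.
Unshelve. all: by end_near. Qed.

Lemma gint_odd f : subexp f -> (forall t, f (- t) = - f t) -> gint f = 0.
Proof.
move=> hf fN; suff : gint f = -1 * gint f by lra.
have hfg := continuous_subexp_gaussian hf.
have ifN : mu.-integrable setT
    (EFin \o ((fun t => f t * gaussian t) \o -%R)).
  rewrite [X in _ \o X](_ : _ = fun t => (- 1 * f t) * gaussian t).
    exact/integrable_subexp_gaussian/subexpZ.
  by apply/funext => t /=; rewrite gaussianN fN mulN1r.
rewrite -gintZ//.
rewrite -{1}[gint f](Rintegral_oppr hfg (integrable_subexp_gaussian hf) ifN).
by apply: eq_Rintegral => t _; rewrite gaussianN fN mulN1r.
Qed.

Lemma cvg_subexp_gaussian f (s : R) : subexp f -> `|s| = 1 ->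
  f (s * n%:R) * gaussian (s * n%:R) @[n --> \oo] --> 0.
Proof.
move=> [_ [C [c fC]]] s1; have C0 := subexp_bound_ge0 fC.
(* From (n - (c + 1))^2 >= 0 follows c n - n^2/2 <= (c + 1)^2/2 - n. *)
pose K := C * expR ((c + 1) ^+ 2 / 2).
apply: norm_cvg0.
apply: (@squeeze_cvgr _ _ _ _ (fun=> 0) (fun n => K * expR (- n%:R))).
- near=> n; rewrite normr_ge0/= normrM [`|gaussian _|]ger0_norm ?gaussian_ge0//.
  apply: le_trans (ler_wpM2r (gaussian_ge0 _) (fC _)) _.
  rewrite -!mulrA ler_wpM2l// /gaussian -!expRD ler_expR.
  rewrite -(real_normK (num_real (s * n%:R))) normrM s1 mul1r normr_nat.
  have := sqr_ge0 (n%:R - (c + 1)); lra.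
- exact: cvg_cst.
- rewrite -[X in _ --> X](mulr0 K); apply: cvgM; first exact: cvg_cst.
  exact: cvgn_expR.
Unshelve. all: by end_near. Qed.

(** The derivative of f e^(-t^2/2) is (g - t f) e^(-t^2/2). Its integral over [-n, n] is a
    difference of boundary values, which tend to 0. *)
Lemma gint_by_parts f g : subexp f -> subexp g ->
  (forall t, is_derive t 1 f (g t)) -> gint (fun t => t * f t) = gint g.
Proof.
move=> hf hg dfg.
pose h t := g t + -1 * (t * f t).
have hh : subexp h by apply/subexpD/subexpZ/subexpM => //; exact: subexp_id.
have dF t : is_derive t 1 (fun t => f t * gaussian t) (h t * gaussian t).
  have df := dfg t; have dg := is_derive_gaussian t.
  by apply: is_derive_eq; rewrite /h /GRing.scale/=; ring.
suff : gint h = 0.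
  rewrite gintD ?gintZ//; try exact/subexpM/hf/subexp_id.
    by rewrite mulN1r => /eqP; rewrite subr_eq0 => /eqP.
  exact/subexpZ/subexpM/hf/subexp_id.
have cv := cvg_Rintegral_itvNn (integrable_subexp_gaussian hh).
apply: (cvg_unique _ cv) => //=.
have c1 := cvg_subexp_gaussian hf (normr1 _).
have c2 := cvg_subexp_gaussian hf (normrN1 _).
rewrite -[X in _ --> X](subrr 0).
apply: cvg_trans (cvgB c1 c2); apply: near_eq_cvg; near=> n.
have n0 : 0 < n%:R :> R by rewrite ltr0n; near: n; exact: nbhs_infty_gt.
rewrite !fctE /= mul1r mulN1r.
have cF t : {for t, continuous (fun t => f t * gaussian t)}.
  exact: continuous_subexp_gaussian.
rewrite /Rintegral.
have -> := @continuous_FTC2 R (fun t => h t * gaussian t)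
  (fun t => f t * gaussian t) (- n%:R) n%:R => //.
- by lra.
- exact/continuous_subspaceT/continuous_subexp_gaussian.
- split => [t _||]; first by have [] := dF t.
    by apply: cvg_at_right_filter; exact: cF.
  by apply: cvg_at_left_filter; exact: cF.
- by move=> t _; have dFt := dF t; rewrite derive1E derive_val.
Unshelve. all: by end_near. Qed.

End GaussianIntegrationByParts.

(** * Tools for the moments: derivatives of powers, Gamma, term-by-term integration *)

Section GaussianMoments.
Variable R : realType.
Local Open Scope classical_set_scope.
Local Notation mu := (@lebesgue_measure R).
Implicit Types (f g F : R -> R) (a t x : R).

Lemma is_derive_odd f (df t : R) : (forall u, f (- u) = - f u) ->
  is_derive (- t) 1 f df -> is_derive t 1 f df.
Proof.
move=> fN hf; have -> : f = fun u => - f (- u).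
  by apply/funext => u; rewrite fN opprK.
have hN : is_derive t (1 : R) (f \o -%R) (df * - 1) by exact: is_derive1_comp.
by rewrite -[df]opprK -[X in - X]mulrN1; exact: is_deriveN.
Qed.

(** The extra factor u gives differentiability at 0 as well: for a > 0 the difference quotient there
    is |h|^a, which tends to 0. Positive t follow from the power rule, negative t from oddness. *)
Lemma is_derive_powR_norm_id a t : 0 <= a ->
  is_derive t 1 (fun u => `|u| `^ a * u) ((a + 1) * `|t| `^ a).
Proof.
rewrite le_eqVlt => /predU1P[<-|a0].
  under eq_fun do rewrite powRr0 mul1r.
  by apply: is_derive_eq; rewrite powRr0 add0r mul1r.
have pos (u : R) : 0 < u ->
    is_derive u (1 : R) (fun u : R => `|u| `^ a * u) ((a + 1) * `|u| `^ a).
  move=> u0; apply: (@near_eq_is_derive _ _ _ (fun u : R => u `^ a * u)).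
  - near=> v; rewrite ger0_norm// ltW//; near: v; exact: lt_nbhsr.
  - have hu := is_derive1_powR a u0; apply: is_derive_eq.
    rewrite /GRing.scale/= ger0_norm ?ltW//.
    have -> : u `^ a = u * u `^ (a - 1) by rewrite mulr_powRB1// ltW.
    ring.
have [t0|t0|->] := ltgtP t 0; last 2 first.
- exact: pos.
- have d0 : (fun h : R => h^-1 *: (((fun u : R => `|u| `^ a * u) \o shift 0) (h *: 1)
      - `|0 : R| `^ a * 0)) @ 0^' --> (a + 1) * `|0 : R| `^ a.
    rewrite normr0 powR0 ?gt_eqF// !mulr0.
    have := @continuous_powR_norm R a (ltW a0) 0.
    rewrite /continuous_at normr0 powR0 ?gt_eqF// => h.
    have h' : `|u| `^ a @[u --> (0 : R)^'] --> (0 : R) by exact: cvg_within_filter h.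
    apply: cvg_trans h'; apply: near_eq_cvg; near=> u.
    have u0 : u != 0 by near: u; exact: nbhs_dnbhs_neq.
    by rewrite /= /GRing.scale/= subr0 mulr1 addr0 mulrCA mulVf ?mulr1.
  by apply: DeriveDef; [apply/cvg_ex; eexists; exact: d0|exact: cvg_lim d0].
- apply: is_derive_odd => [u|]; first by rewrite normrN mulrN.
  by rewrite -normrN; apply: pos; rewrite oppr_gt0.
Unshelve. all: by end_near. Qed.

(** Monotone convergence along an exhaustion of the open half-line by compact intervals. *)
Lemma cvg_integral_itv0y f (a b : nat -> R) :
  (forall t, 0 < t -> 0 <= f t) -> measurable_fun (`]0%R, +oo[ : set R) f ->
  {homo a : n m / (n <= m)%N >-> m <= n} ->
  {homo b : n m / (n <= m)%N >-> n <= m} ->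
  (forall n, 0 < a n) -> (forall t, 0 < t -> exists n, a n <= t <= b n) ->
  (\int[mu]_(t in `[a n, b n]) (f t)%:E)%E @[n --> \oo] -->
  (\int[mu]_(t in `]0%R, +oo[) (f t)%:E)%E.
Proof.
move=> f0 mf ha hb a0 cov.
have sub n : `[a n, b n] `<=` `]0, +oo[.
  move=> t /=; rewrite !in_itv/= andbT => /andP[+ _].
  exact: lt_le_trans.
have -> : (`]0%R, +oo[ : set R) = \bigcup_n `[a n, b n].
  apply/seteqP; split => [t|t [n _]]; last exact: sub.
  rewrite /= in_itv/= andbT => /cov[n abn].
  by exists n; [|rewrite /= in_itv].

apply: (@ge0_nondecreasing_set_cvg_integral _ (measurableTypeR R) R
  (fun n => `[a n, b n]%classic) (EFin \o f) lebesgue_measure).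
- move=> n m nm; rewrite subsetEset => t /=; rewrite !in_itv/= => /andP[at_ tb].
  by rewrite (le_trans (ha _ _ nm) at_) (le_trans tb (hb _ _ nm)).
- by [].
- by move=> n; apply/measurable_EFinP; exact: measurable_funS mf.
- move=> n t /sub /=; rewrite in_itv/= andbT lee_fin; exact: f0.
Qed.

(** Substitution u = t^2/2 in Euler's integral, carried out on compact intervals and then passed to
    the limit on both sides. *)
Lemma Gamma_gaussian s : 0 < s ->
  Gamma ((s + 1) / 2) = \int[mu]_(t in `]0, +oo[)
    ((2 `^ ((s - 1) / 2))^-1 * (`|t| `^ s * gaussian t)).
Proof.
move=> s0; rewrite /Gamma /Rintegral; congr fine.
have -> : (s + 1) / 2 - 1 = (s - 1) / 2 by lra.
set p := (s - 1) / 2.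
(* The intervals [1/(n+1), n+1] stay away from 0, where t^p is singular when p is negative. *)
pose a n : R := n.+1%:R^-1; pose b n : R := n.+1%:R.
pose sq (t : R) := t ^+ 2 / 2.
have a0 n : 0 < a n by rewrite invr_gt0 ltr0Sn.
have b0 n : 0 < b n by rewrite ltr0Sn.
have ha : {homo a : n m / (n <= m)%N >-> m <= n}.
  by move=> n m nm; rewrite lef_pV2 ?posrE ?ltr0Sn// ler_nat.
have hb : {homo b : n m / (n <= m)%N >-> n <= m}.
  by move=> n m nm; rewrite ler_nat.
have cov t : 0 < t -> exists n, a n <= t <= b n.
  (* The two bounds dominate t and 1/t respectively. *)
  move=> t0; exists (Num.bound t + Num.bound t^-1)%N.
  have h1 := archi_boundP (ltW t0).
  have t'0 : 0 < t^-1 by rewrite invr_gt0.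
  have h2 := archi_boundP (ltW t'0).
  have d1 : 0 <= (Num.bound t)%:R :> R by [].
  have d2 : 0 <= (Num.bound t^-1)%:R :> R by [].
  have e : (Num.bound t + Num.bound t^-1).+1%:R =
           (Num.bound t)%:R + (Num.bound t^-1)%:R + 1 :> R.
    by rewrite -natr1 natrD.
  rewrite /a /b invf_ple ?posrE ?ltr0Sn// e; apply/andP; split; lra.
have sqle u v : 0 < u -> 0 < v -> (sq u <= sq v) = (u <= v).
  by move=> u0 v0; rewrite /sq ler_pM2r ?invr_gt0// ler_pXn2r// nnegrE ltW.
have sqlt u v : 0 < u -> 0 < v -> (sq u < sq v) = (u < v).
  by move=> u0 v0; rewrite !ltNge sqle.
have sq0 u : 0 < u -> 0 < sq u by move=> u0; rewrite divr_gt0// exprn_gt0.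
have contG t : 0 < t -> {for t, continuous (fun t => t `^ p * expR (- t))}.
  move=> t0; have c1 : {for t, continuous (fun t : R => t `^ p)}.
    apply/differentiable_continuous/derivable1_diffP.
    by apply: derivable_powR; rewrite in_itv/= andbT.
  have c2 : {for t, continuous (fun t : R => expR (- t))}.
    by apply: (@continuous_comp _ _ _ -%R (@expR R));
      [exact: continuousN|exact: continuous_expR].
  exact: cvgM c1 c2.
have lhs := @cvg_integral_itv0y (fun t => t `^ p * expR (- t))
  (sq \o a) (sq \o b).
have rhs := @cvg_integral_itv0y
  (fun t => (2 `^ p)^-1 * (`|t| `^ s * gaussian t)) a b.
(* One factor t of t^s is the derivative of [sq]; the rest comes from (t^2/2)^p = 2^(-p) t^(s-1). *)
have e n : (\int[mu]_(t in `[sq (a n), sq (b n)]) (t `^ p * expR (- t))%:E)%E =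
  (\int[mu]_(t in `[a n, b n]) ((2 `^ p)^-1 * (`|t| `^ s * gaussian t))%:E)%E.
  have dsq : sq^`() = id.
    apply/funext => t; rewrite derive1E /sq derive_val /GRing.scale/=; lra.
  have csq : continuous sq.
    by move=> t; apply/differentiable_continuous/derivable1_diffP/ex_derive.
  rewrite (@integration_by_substitution_increasing _ sq) ?dsq.
  - apply: eq_integral => t; rewrite inE/= in_itv/= => /andP[at_ _].
    have t0 : 0 < t by exact: lt_le_trans at_.
    rewrite !fctE /sq /gaussian ger0_norm ?ltW//; congr EFin.
    have -> : t `^ s = t `^ (s - 1) * t by rewrite mulrC mulr_powRB1// ltW.
    have -> : (t ^+ 2 / 2) `^ p = (2 `^ p)^-1 * t `^ (s - 1).
      rewrite powRM ?invr_ge0 ?sqr_ge0// -(powR_mulrn 2 (ltW t0)) -powRrM.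
      rewrite -powR_inv1// -powRrM mulN1r powRN mulrC; congr (_ * t `^ _).
      by rewrite /p mulrC divfK.
    by rewrite mulNr; ring.
  - by rewrite (@le_trans _ _ 1)// /a /b ?ler1n// invf_le1 ?ltr0Sn// ler1n.
  - move=> u v; rewrite !in_itv/= => /andP[au _] /andP[av _] uv.
    by rewrite sqlt// ?(lt_le_trans (a0 n)).
  - by move=> t _; exact: cvg_id.
  - by apply/cvg_ex; exists (a n); apply: cvg_at_right_filter; exact: cvg_id.
  - by apply/cvg_ex; exists (b n); apply: cvg_at_left_filter; exact: cvg_id.
  - split => [t _||]; first exact: ex_derive.
    by apply: cvg_at_right_filter; exact: csq.
    by apply: cvg_at_left_filter; exact: csq.
  - apply: continuous_in_subspaceT => t; rewrite inE/= in_itv/= => /andP[at_ _].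
    exact/contG/(lt_le_trans _ at_)/sq0.
apply: (cvg_unique _ (lhs _ _ _ _ _ _)) => //=.
- by move=> t _; rewrite mulr_ge0 ?powR_ge0 ?expR_ge0.
- apply: measurable_funM; apply: measurable_funTS; first exact: measurable_powR.
  by apply: measurableT_comp; [exact: measurable_expR|exact: measurable_funN].
- by move=> n m nm; rewrite sqle// ha.
- by move=> n m nm; rewrite sqle// hb.
- by move=> n; exact: sq0.
(* The image intervals cover t because the original ones cover its preimage sqrt(2t) under [sq]. *)
- move=> t t0; have t2 : 0 < 2 * t by rewrite mulr_gt0.
  have r0 : 0 < Num.sqrt (2 * t) by rewrite sqrtr_gt0.
  have [n /andP[an nb]] := cov _ r0; exists n.
  have -> : t = sq (Num.sqrt (2 * t)) by rewrite /sq sqr_sqrtr ?ltW//; lra.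
  by rewrite !sqle// an nb.
apply: cvg_trans (rhs _ _ ha hb a0 cov).
- by apply: near_eq_cvg; near=> n; rewrite -e.
- by move=> t _; rewrite !mulr_ge0 ?invr_ge0 ?powR_ge0 ?gaussian_ge0.
- apply: measurable_funTS; apply: measurable_funM => //.
  apply: continuous_measurable_fun.
  exact/continuous_subexp_gaussian/subexp_powR_norm/ltW.
Unshelve. all: by end_near. Qed.

(** Dominated convergence for the partial sums, with majorant |f B| e^(-t^2/2). *)
Lemma cvg_gint_series f (u : nat -> R -> R) h B :
  subexp f -> (forall j, subexp (u j)) -> subexp h -> subexp B ->
  (forall t, series (u ^~ t) @ \oo --> h t) ->
  (forall n t, `|series (u ^~ t) n| <= B t) ->
  series (fun j => gint (fun t => f t * u j t)) @ \oo -->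
  gint (fun t => f t * h t).
Proof.
move=> hf hu hh hB uh uB.
pose f_ n t := (f t * series (u ^~ t) n * gaussian t)%:E.
have sf n : subexp (fun t => f t * series (u ^~ t) n).
  by apply: subexpM => //; exact: subexp_sum.
have mf_ n : measurable_fun setT (f_ n).
  exact: measurable_int (integrable_subexp_gaussian (sf n)).
have ih := integrable_subexp_gaussian (subexpM hf hh).
have f_h : {ae mu, forall t, setT t ->
    f_ ^~ t @ \oo --> (f t * h t * gaussian t)%:E}.
  apply: aeW => t _; apply: cvg_EFin; first by near=> n.
  by apply: cvgM; [apply: cvgM; [exact: cvg_cst|exact: uh]|exact: cvg_cst].
have f_le : {ae mu, forall t n, setT t ->
    (`|f_ n t| <= (`|f t * B t * gaussian t|)%:E)%E}.
  apply: aeW => t n _; rewrite lee_fin !normrM ler_wpM2r// ler_wpM2l//.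
  exact: le_trans (uB n t) (ler_norm _).
have [_ _] := @dominated_convergence _ _ R mu setT measurableT _ _ _
  mf_ (measurable_int _ ih) f_h
  (integrable_norm (integrable_subexp_gaussian (subexpM hf hB))) f_le.
have ifin : (\int[mu]_t (f t * h t * gaussian t)%:E)%E \is a fin_num.
  exact: integrable_fin_num.
rewrite -[X in _ --> X]fineK// => /fine_cvg; apply: cvg_trans.
apply: near_eq_cvg; near=> n; rewrite /= -/(Rintegral _ _ _).
rewrite /series/= -gint_sum; last by move=> j; exact: subexpM.
by apply: eq_Rintegral => t _; rewrite mulr_sumr.
Unshelve. all: by end_near. Qed.

Lemma series_exp_coeff_le t n : 0 <= t -> series (exp_coeff t) n <= expR t.
Proof.
move=> t0; rewrite /expR; apply: nondecreasing_cvgn_le; last first.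
  exact: is_cvg_series_exp_coeff.
by apply: nondecreasing_series => k _ _; exact: exp_coeff_ge0.
Qed.

(** In absolute value, the first n cosine terms are the even-indexed ones among the first 2n terms
    of the exponential series at |t|; for the sine they are the odd-indexed ones. *)
Lemma norm_cos_series_le t n : `|series (cos_coeff' t) n| <= expR `|t|.
Proof.
apply: le_trans (ler_norm_sum _ _ _) _.
apply: le_trans (series_exp_coeff_le n.*2 (normr_ge0 t)).
elim: n => [|n ih]; first by rewrite /series/= !big_geq.
rewrite doubleS /series/= !big_nat_recr//= -addrA lerD//.
rewrite /cos_coeff' /exp_coeff/= !normrM normfV normrX normrN1 expr1n mul1r.
rewrite normr_nat normrX lerDl; exact: exp_coeff_ge0.
Qed.

Lemma norm_sin_series_le t n : `|series (sin_coeff' t) n| <= expR `|t|.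
Proof.
apply: le_trans (ler_norm_sum _ _ _) _.
apply: le_trans (series_exp_coeff_le n.*2 (normr_ge0 t)).
elim: n => [|n ih]; first by rewrite /series/= !big_geq.
rewrite doubleS /series/= !big_nat_recr//= -addrA lerD//.
rewrite /sin_coeff' /exp_coeff/= !normrM normfV normrX normrN1 expr1n mul1r.
rewrite normr_nat normrX lerDr; exact: exp_coeff_ge0.
Qed.

End GaussianMoments.

(** * Moments of |t|^a e^(-t^2/2) and the hypergeometric series *)

Section WeightedCosine.
Variable R : realType.
Local Open Scope classical_set_scope.
Local Notation mu := (@lebesgue_measure R).
Implicit Types (a t x : R) (k m j : nat).

(* For [a = 0] the weight is the constant 1, since [0 `^ 0 = 1]. *)
Definition moment a k : R := gint (fun t => `|t| `^ a * t ^+ k).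

Lemma subexp_powR_norm_exp a k : 0 <= a ->
  subexp (fun t : R => `|t| `^ a * t ^+ k).
Proof.
by move=> a0; apply: subexpM; [exact: subexp_powR_norm|exact/subexpX/subexp_id].
Qed.

Lemma moment_odd a k : 0 <= a -> odd k -> moment a k = 0.
Proof.
move=> a0 ok; apply: gint_odd; first exact: subexp_powR_norm_exp.
by move=> t; rewrite normrN exprNn -signr_odd ok expr1 mulN1r mulrN.
Qed.

(** Integration by parts with |t|^a t^(k+1), whose derivative is (a + k + 1) |t|^a t^k. *)
Lemma moment_rec a k : 0 <= a -> moment a k.+2 = (a + k.+1%:R) * moment a k.
Proof.
move=> a0; have h1 := subexp_powR_norm_exp k.+1 a0.
have h0 := subexp_powR_norm_exp k a0.
rewrite /moment -gintZ//.
transitivity (gint (fun t => t * (`|t| `^ a * t ^+ k.+1))).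
  by congr gint; apply/funext => t; rewrite [in RHS]mulrCA -exprS.
apply: gint_by_parts => //; first exact: subexpZ.
move=> t; have d := is_derive_powR_norm_id t a0.
(* One factor t is kept with |t|^a, which for small a > 0 is not differentiable at 0 by itself. *)
have -> : (fun t => `|t| `^ a * t ^+ k.+1) =
    (fun t : R => (`|t| `^ a * t) * t ^+ k).
  by apply/funext => u; rewrite exprS mulrA.
case: k {h1 h0} => [|k].
  have -> : (fun u : R => `|u| `^ a * u * u ^+ 0) = fun u => `|u| `^ a * u.
    by apply/funext => u; rewrite mulr1.
  by rewrite mulr1.
have dX : is_derive t (1 : R) (fun u : R => u ^+ k.+1) (k.+1%:R * t ^+ k).
  have := is_deriveX k.+1 (is_derive_id t 1).
  by rewrite exprfctE => h; apply: (is_derive_eq h); rewrite /GRing.scale/= mulr1.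
have h := is_deriveM d dX; apply: (is_derive_eq h).
by rewrite /GRing.scale/= -[k.+2%:R]natr1 exprS; ring.
Qed.

Lemma pochhammerS a k : pochhammer a k.+1 = pochhammer a k * (a + k%:R).
Proof. by rewrite /pochhammer big_ord_recr. Qed.

(** Each use of [moment_rec] contributes a + m + 2j + 1 = 2 ((a + m + 1)/2 + j). *)
Lemma moment_addn2 a m j : 0 <= a ->
  moment a (m + j.*2) = 2 ^+ j * pochhammer ((a + m.+1%:R) / 2) j * moment a m.
Proof.
move=> a0; elim: j => [|j ih].
  by rewrite addn0 /pochhammer big_ord0 expr0 !mul1r.
rewrite doubleS !addnS moment_rec// ih pochhammerS exprS.
rewrite -[(m + _).+1%:R]natr1 -[m.+1%:R]natr1 natrD -muln2 natrM.
by field.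
Qed.

(** The inductive step is (2j + 1)(2j + 2) = 4 (j + 1)(1/2 + j). *)
Lemma natr_fact_double j :
  (j.*2)`!%:R = 4 ^+ j * j`!%:R * pochhammer (1 / 2) j :> R.
Proof.
elim: j => [|j ih]; first by rewrite /pochhammer big_ord0 expr0 !mul1r.
rewrite doubleS !factS !natrM ih pochhammerS exprS.
rewrite -[j.*2.+2%:R]natr1 -[j.*2.+1%:R]natr1 -[j.+1%:R]natr1 -muln2 natrM.
by field.
Qed.

(** The inductive step is (2j + 2)(2j + 3) = 4 (j + 1)(3/2 + j). *)
Lemma natr_fact_doubleS j :
  (j.*2.+1)`!%:R = 4 ^+ j * j`!%:R * pochhammer (3 / 2) j :> R.
Proof.
elim: j => [|j ih]; first by rewrite /pochhammer big_ord0 expr0 !mul1r.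
rewrite doubleS (factS j.*2.+2) (factS j.*2.+1) (factS j) pochhammerS exprS.
move: (j.*2.+1)`! ih => F ih; rewrite !natrM ih.
rewrite -[j.*2.+3%:R]natr1 -[j.*2.+2%:R]natr1 -[j.*2.+1%:R]natr1 -[j.+1%:R]natr1.
rewrite -muln2 natrM.
by field.
Qed.

Lemma pochhammer_gt0 a k : 0 < a -> 0 < pochhammer a k.
Proof. by move=> a0; apply: prodr_gt0 => i _; rewrite ltr_wpDr. Qed.

(* Multiplying by [c] outside the limit covers [c = 0], where nothing is known
   about the convergence of [series v]. *)
Lemma mul_limn_series (c l : R) (v : nat -> R) :
  series (fun j => c * v j) @ \oo --> l -> c * limn (series v) = l.
Proof.
have -> : series (fun j => c * v j) = fun n => c * series v n.
  by apply/funext => n; rewrite /series/= mulr_sumr.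
have [->|c0] := eqVneq c 0.
  under eq_fun do rewrite mul0r; move=> h.
  by rewrite mul0r; apply: cvg_unique h => //; exact: cvg_cst.
move=> h; have : series v @ \oo --> c^-1 * l.
  have -> : series v = fun n => c^-1 * (c * series v n).
    by apply/funext => n; rewrite mulKf.
  by apply: cvgM => //; exact: cvg_cst.
by move/cvg_lim => ->//; rewrite mulVKf.
Qed.

(** Term by term, the moment of order m + 2j supplies 2^j and the upper Pochhammer symbol, and (2j)!
    supplies 4^j j! and the lower one; the remaining 2^(-j) turns (-x^2)^j into (-x^2/2)^j. *)
Lemma gint_cos a m x : 0 <= a ->
  gint (fun t => `|t| `^ a * t ^+ m * cos (x * t)) =
  moment a m * hyp1F1 ((a + m.+1%:R) / 2) (1 / 2) (- x ^+ 2 / 2).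
Proof.
move=> a0; have h0 := subexp_powR_norm_exp m a0.
apply/esym/mul_limn_series.
have su j : subexp (fun t => cos_coeff' (x * t) j).
  rewrite /cos_coeff'; apply: subexpM; last exact: subexp_cst.
  exact/subexpZ/subexpX/subexpZ/subexp_id.
have := cvg_gint_series h0 su (subexp_cos x) (subexp_expR_norm `|x|).
have H1 t : series (cos_coeff' (x * t)) @ \oo --> cos (x * t).
  exact: cvg_cos_coeff'.
have H2 n t : `|series (cos_coeff' (x * t)) n| <= expR (`|x| * `|t|).
  by rewrite -normrM; exact: norm_cos_series_le.
move=> /(_ H1 H2); apply: cvg_trans; apply: near_eq_cvg; near=> n.
apply: eq_bigr => j _; rewrite /cos_coeff'.
transitivity (gint (fun t : R => ((-1) ^+ j * x ^+ j.*2 / (j.*2)`!%:R) *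
    (`|t| `^ a * t ^+ (m + j.*2)))).
  congr gint; apply/funext => t; rewrite exprMn exprD -exprnP; ring.
rewrite gintZ; last exact: subexp_powR_norm_exp.
rewrite -/(moment _ _) moment_addn2// natr_fact_double.
have p0 : pochhammer (1 / 2 : R) j != 0 by rewrite gt_eqF// pochhammer_gt0.
have f0 : j`!%:R != 0 :> R by rewrite pnatr_eq0 -lt0n fact_gt0.
have -> : - x ^+ 2 / 2 = (-1) * x ^+ 2 * 2^-1 by rewrite mulN1r.
rewrite [in RHS]/= !exprMn exprVn -addnn exprD.
have -> : (4 : R) ^+ j = 2 ^+ j * 2 ^+ j by rewrite -exprMn -natrM.
have t0 : (2 : R) ^+ j != 0 by rewrite expf_neq0.
by field; rewrite t0 f0 p0.
Unshelve. all: by end_near. Qed.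

Lemma gint_sin a m x : 0 <= a ->
  gint (fun t => `|t| `^ a * t ^+ m * sin (x * t)) =
  x * moment a m.+1 * hyp1F1 ((a + m.+2%:R) / 2) (3 / 2) (- x ^+ 2 / 2).
Proof.
move=> a0; have h0 := subexp_powR_norm_exp m a0.
apply/esym/mul_limn_series.
have su j : subexp (fun t => sin_coeff' (x * t) j).
  rewrite /sin_coeff'; apply: subexpM; last exact: subexp_cst.
  exact/subexpZ/subexpX/subexpZ/subexp_id.
have := cvg_gint_series h0 su (subexp_sin x) (subexp_expR_norm `|x|).
have H1 t : series (sin_coeff' (x * t)) @ \oo --> sin (x * t).
  exact: cvg_sin_coeff'.
have H2 n t : `|series (sin_coeff' (x * t)) n| <= expR (`|x| * `|t|).
  by rewrite -normrM; exact: norm_sin_series_le.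
move=> /(_ H1 H2); apply: cvg_trans; apply: near_eq_cvg; near=> n.
apply: eq_bigr => j _; rewrite /sin_coeff'.
transitivity (gint (fun t : R => ((-1) ^+ j * x ^+ j.*2.+1 / (j.*2.+1)`!%:R) *
    (`|t| `^ a * t ^+ (m.+1 + j.*2)))).
  congr gint; apply/funext => t.
  by rewrite exprMn addSnnS exprD -exprnP; ring.
rewrite gintZ; last exact: subexp_powR_norm_exp.
rewrite -/(moment _ _) moment_addn2// natr_fact_doubleS.
have p0 : pochhammer (3 / 2 : R) j != 0 by rewrite gt_eqF// pochhammer_gt0.
have f0 : j`!%:R != 0 :> R by rewrite pnatr_eq0 -lt0n fact_gt0.
have -> : - x ^+ 2 / 2 = (-1) * x ^+ 2 * 2^-1 by rewrite mulN1r.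
rewrite [in RHS]/= exprS !exprMn exprVn -addnn exprD.
have -> : (4 : R) ^+ j = 2 ^+ j * 2 ^+ j by rewrite -exprMn -natrM.
have t0 : (2 : R) ^+ j != 0 by rewrite expf_neq0.
by field; rewrite t0 f0 p0.
Unshelve. all: by end_near. Qed.

Lemma hyp1F1_refl a x : 0 < a -> hyp1F1 a a x = expR x.
Proof.
move=> a0; rewrite /hyp1F1 /expR; congr (limn (series _)); apply/funext => k.
by rewrite /= divff ?mul1r// gt_eqF// pochhammer_gt0.
Qed.

(** For a = m = 0 both hypergeometric parameters are 1/2, so the series collapses to the
    exponential. *)
Lemma gint_cos_gaussian x :
  gint (fun t => cos (x * t)) = Num.sqrt (2 * pi) * gaussian x.
Proof.
have := @gint_cos 0 0%N x (lexx 0).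
have -> : moment 0 0 = Num.sqrt (2 * pi).
  rewrite -(gint1 R) /moment; congr gint; apply/funext => t.
  by rewrite powRr0 expr0 mulr1.
rewrite add0r hyp1F1_refl// => <-; congr gint; apply/funext => t.
by rewrite powRr0 expr0 !mul1r.
Qed.

(** The integrand is the even function |t|^s e^(-t^2/2) with s = a + 2m. Folding it onto the
    half-line gives a factor 2, and 2 * 2^((s-1)/2) = 2^((s+1)/2). *)
Lemma moment_even a m : 0 < a ->
  moment a m.*2 = 2 `^ ((a + m.*2.+1%:R) / 2) * Gamma ((a + m.*2.+1%:R) / 2).
Proof.
move=> a0; set s := a + m.*2%:R.
have s0 : 0 < s by rewrite ltr_wpDr.
have -> : a + m.*2.+1%:R = s + 1 by rewrite -natr1 addrA.
have hs := subexp_powR_norm (ltW s0).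
have cs := continuous_subexp_gaussian hs.
have is_ := integrable_subexp_gaussian hs.
have -> : moment a m.*2 = gint (fun t => `|t| `^ s).
  rewrite /moment; congr gint; apply/funext => t; rewrite /s powRD; last first.
    by rewrite gt_eqF.
  rewrite powR_mulrn// -[in RHS]normrX (@ger0_norm _ (t ^+ m.*2))//.
  by rewrite -muln2 exprM sqr_ge0.
have iy : mu.-integrable `]0, +oo[ (EFin \o (fun t : R => `|t| `^ s * gaussian t)).
  exact: integrableS is_.
rewrite Gamma_gaussian// RintegralZl//.
rewrite /gint /Rintegral ge0_symfun_integralT//; last 2 first.
- by move=> t; rewrite mulr_ge0 ?powR_ge0 ?gaussian_ge0.
- by move=> t; rewrite /= normrN gaussianN.
have -> : [set x : R | 0 <= x] = (`[0, +oo[ : set R).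
  by apply/seteqP; split => t; rewrite /= in_itv/= andbT.
rewrite -integral_itv_obnd_cbnd; last exact: measurable_int iy.
rewrite fineM//; last exact: integrable_fin_num.
rewrite mulrA; congr (_ * _).
rewrite -powRB; last by rewrite pnatr_eq0 implybT.
by rewrite (_ : _ - _ = 1) ?powRr1//; lra.
Qed.

End WeightedCosine.

(** * Hermite polynomials and their Fourier transforms *)

Section HermiteFourier.
Variable R : realType.
Implicit Types (a t x xi : R) (k m n : nat) (p : {poly R}).

Local Notation H := (hermite R).

Lemma hermite0 : H 0 = 1%:P.
Proof. by rewrite polyC1. Qed.

Lemma hermite1 : H 1 = 2 *: 'X.
Proof. by []. Qed.

Lemma hermiteSS n :
  H n.+2 = 2 *: ('X * H n.+1) - (2 * n.+1%:R) *: H n.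
Proof. by []. Qed.

Lemma deriv_hermite n : (H n.+1)^`() = (2 * n.+1%:R) *: H n.
Proof.
suff : (H n.+1)^`() = (2 * n.+1%:R) *: H n /\
       (H n.+2)^`() = (2 * n.+2%:R) *: H n.+1 by case.
(* Differentiating the three-term recurrence leaves 2 H_(k+1) + 2(k+1)(2 X H_k - H_k'), and the
   second hypothesis identifies the bracket with H_(k+1). *)
have step k : (H k.+1)^`() = (2 * k.+1%:R) *: H k ->
    2 *: ('X * H k) - (H k)^`() = H k.+1 ->
    (H k.+2)^`() = (2 * k.+2%:R) *: H k.+1.
  move=> h1 h2; rewrite hermiteSS derivB !derivZ derivM derivX mul1r h1.
  rewrite -[k.+2%:R]natr1 -[in RHS]h2 -[in LHS]h2 -!mul_polyC !polyCM !polyCD.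
  by ring.
elim: n => [|n [ih1 ih2]].
  split; first by rewrite derivZ derivX mulr1.
  apply: step; first by rewrite derivZ derivX mulr1.
  by rewrite hermite0 derivC subr0 polyC1 mulr1.
split => //; apply: step => //.
by rewrite ih1 hermiteSS.
Qed.

Lemma hermiteS n : H n.+1 = 2 *: ('X * H n) - (H n)^`().
Proof.
case: n => [|n]; first by rewrite hermite0 derivC subr0 polyC1 mulr1.
by rewrite deriv_hermite.
Qed.

(** Reading off coefficients in [hermiteS] gives exactly the recurrence that defines [acoef]. *)
Lemma coef_hermite n k : (H n)`_k = acoef R n k.
Proof.
elim: n k => [|[_|n ih]] k; first by rewrite coef1; case: k.
  by rewrite hermite1 coefZ coefX; case: k => [|[|k]]; rewrite /= ?mulr0 ?mulr1.
rewrite hermiteS coefB coefZ coefXM coef_deriv !ih.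
case: k => [|k]; first by rewrite mulr0 add0r acoefS0.
by rewrite (@acoefSS _ n.+1 k.+1)// [_ * acoef R _ k.+2]mulr_natl.
Qed.

Lemma horner_hermite n N x : (n < N)%N ->
  (H n).[x] = \sum_(k < N) acoef R n k * x ^+ k.
Proof.
move=> nN; rewrite (@horner_coef_wide _ N).
  by apply: eq_bigr => k _; rewrite coef_hermite.
by apply/leq_sizeP => k Nk; rewrite coef_hermite acoef_gt// (leq_trans nN).
Qed.

Lemma cintegral_gint (z : R[i]) (u v : R -> R) : subexp u -> subexp v ->
  cintegral (fun t => z * ((u t * gaussian t) +i* (v t * gaussian t))) =
  z * (gint u +i* gint v).
Proof.
case: z => b c hu hv; have hb r := subexpZ r hu; have hc r := subexpZ r hv.
rewrite /cintegral; simpc; congr (_ +i* _).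
  rewrite -mulNr -!gintZ// -gintD//; apply: eq_Rintegral => t _.
  by rewrite /=; ring.
rewrite -!gintZ// -gintD//; apply: eq_Rintegral => t _.
by rewrite /=; ring.
Qed.

(* Up to the factor [1 / sqrt (2 pi)], the Fourier transform of
   [p(t) exp(- t ^ 2 / 2)]. *)
Definition polyFT p xi : R[i] :=
  gint (fun t => p.[t] * cos (xi * t)) +i* - gint (fun t => p.[t] * sin (xi * t)).

(** Integration by parts: the derivative of p(t) e^(-i xi t) is (p'(t) - i xi p(t)) e^(-i xi t).
    Real and imaginary parts are handled separately. *)
Lemma polyFT_mulX p xi :
  polyFT ('X * p) xi = polyFT p^`() xi - 'i%C * xi%:C * polyFT p xi.
Proof.
have hc q := subexpM (subexp_horner q) (subexp_cos xi).
have hs q := subexpM (subexp_horner q) (subexp_sin xi).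
have dc t : is_derive t (1 : R) (fun t => cos (xi * t)) (- xi * sin (xi * t)).
  apply: is_derive_eq; rewrite /GRing.scale/=; ring.
have ds t : is_derive t (1 : R) (fun t => sin (xi * t)) (xi * cos (xi * t)).
  apply: is_derive_eq; rewrite /GRing.scale/=; ring.
have ec : gint (fun t => ('X * p).[t] * cos (xi * t)) =
  gint (fun t => p^`().[t] * cos (xi * t)) -
    xi * gint (fun t => p.[t] * sin (xi * t)).
  rewrite -mulNr -gintZ// -gintD//; last exact: subexpZ.
  transitivity (gint (fun t => t * (p.[t] * cos (xi * t)))).
    by congr gint; apply/funext => t; rewrite hornerM hornerX mulrA.
  apply: gint_by_parts => //; first exact/subexpD/subexpZ.
  move=> t; have h := is_deriveM (is_derive_poly p t) (dc t).
  by apply: (is_derive_eq h); rewrite /GRing.scale/=; ring.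
have es : gint (fun t => ('X * p).[t] * sin (xi * t)) =
  gint (fun t => p^`().[t] * sin (xi * t)) +
    xi * gint (fun t => p.[t] * cos (xi * t)).
  rewrite -gintZ// -gintD//; last exact: subexpZ.
  transitivity (gint (fun t => t * (p.[t] * sin (xi * t)))).
    by congr gint; apply/funext => t; rewrite hornerM hornerX mulrA.
  apply: gint_by_parts => //; first exact/subexpD/subexpZ.
  move=> t; have h := is_deriveM (is_derive_poly p t) (ds t).
  by apply: (is_derive_eq h); rewrite /GRing.scale/=; ring.
rewrite /polyFT ec es; simpc; congr (_ +i* _); ring.
Qed.

Lemma polyFT_linear (r s : R) p q xi :
  polyFT (r *: p + s *: q) xi = r%:C * polyFT p xi + s%:C * polyFT q xi.
Proof.
have hc q' := subexpM (subexp_horner q') (subexp_cos xi).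
have hs q' := subexpM (subexp_horner q') (subexp_sin xi).
have e (f : R -> R) : (forall q', subexp (fun t => q'.[t] * f t)) ->
    gint (fun t => (r *: p + s *: q).[t] * f t) =
    r * gint (fun t => p.[t] * f t) + s * gint (fun t => q.[t] * f t).
  move=> hf; rewrite -!gintZ// -gintD//; try exact: subexpZ.
  by congr gint; apply/funext => t; rewrite hornerD !hornerZ; ring.
by rewrite /polyFT !e//; simpc; congr (_ +i* _); ring.
Qed.

Lemma polyFT1 xi : polyFT 1 xi = (Num.sqrt (2 * pi) * gaussian xi)%:C.
Proof.
rewrite /polyFT -gint_cos_gaussian; congr (_ +i* _).
  by congr gint; apply/funext => t; rewrite hornerC mul1r.
rewrite gint_odd ?oppr0//; first exact: subexpM (subexp_horner _) (subexp_sin _).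
by move=> t; rewrite !hornerC !mul1r mulrN sinN.
Qed.

Lemma polyFT_hermiteS n xi :
  polyFT (H n.+1) xi = polyFT (H n)^`() xi - 2 * 'i%C * xi%:C * polyFT (H n) xi.
Proof.
rewrite hermiteS -scaleN1r polyFT_linear polyFT_mulX.
have -> : (2 : R)%:C = 2 by rewrite rmorph_nat.
have -> : (-1 : R)%:C = -1 by rewrite rmorphN rmorph1.
by ring.
Qed.

(** With H_(n+1)' = 2(n+1) H_n, [polyFT_hermiteS] becomes a three-term recurrence, so the induction
    carries two consecutive indices. *)
Lemma polyFT_hermite n xi :
  polyFT (H n) xi =
  (- 'i%C) ^+ n * ((H n).[xi] * (Num.sqrt (2 * pi) * gaussian xi))%:C.
Proof.
set g := Num.sqrt (2 * pi) * gaussian xi.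
suff : polyFT (H n) xi = (- 'i%C) ^+ n * ((H n).[xi] * g)%:C /\
  polyFT (H n.+1) xi = (- 'i%C) ^+ n.+1 * ((H n.+1).[xi] * g)%:C by case.
have i2 : 'i%C * 'i%C = -1 :> R[i] by rewrite -expr2 sqr_i.
elim: n => [|n [ih1 ih2]].
  have e0 : polyFT (H 0) xi = (- 'i%C) ^+ 0 * ((H 0).[xi] * g)%:C.
    by rewrite polyFT1 hornerC expr0 !mul1r.
  split => //; rewrite polyFT_hermiteS e0 derivC.
  have -> : polyFT 0 xi = 0.
    have := polyFT_linear 0 0 0 0 xi; rewrite !scale0r addr0 => ->.
    by rewrite !mul0r addr0.
  rewrite hornerZ hornerX hornerC !mul1r !rmorphM rmorph_nat; ring.
split => //; rewrite polyFT_hermiteS deriv_hermite.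
have -> : polyFT ((2 * n.+1%:R) *: H n) xi = (2 * n.+1%:R)%:C * polyFT (H n) xi.
  have := polyFT_linear (2 * n.+1%:R) 0 (H n) 0 xi.
  by rewrite scale0r addr0 mul0r addr0.
rewrite ih1 ih2 hermiteSS hornerD hornerN !hornerZ hornerM hornerX.
move: (H n.+1).[xi] (H n).[xi] {ih1 ih2} => h1 h0.
rewrite !(rmorphM, rmorphB, rmorph_nat)/= !exprS.
set P := (- 'i%C) ^+ n; set G := _%:C * _%:C; set k := n.+1%:R.
(* The product i * i is kept as a visible factor, since [ring] does not know that it equals -1. *)
transitivity (2 * k * P * h0%:C * G + 'i%C * 'i%C * (2 * xi%:C * P * h1%:C * G)).
  by ring.
transitivity ('i%C * 'i%C * (2 * xi%:C * h1%:C - 2 * k * h0%:C) * P * G).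
  by rewrite i2; ring.
by ring.
Qed.

Lemma fourier_hermite_fun n xi :
  fourier (fun t => (hermite_fun n t)%:C) xi =
  (- 'i%C) ^+ n * (hermite_fun n xi)%:C.
Proof.
rewrite /fourier; pose c : R := (Num.sqrt (2 ^+ n * n`!%:R))^-1.
have hc := subexpM (subexp_horner (H n)) (subexp_cos xi).
have hs := subexpM (subexp_horner (H n)) (subexp_sin xi).
have -> : (fun x => (hermite_fun n x)%:C * expi (- (x * xi))) = fun t =>
  c%:C * (((H n).[t] * cos (xi * t) * gaussian t) +i*
          (-1 * ((H n).[t] * sin (xi * t)) * gaussian t)).
  apply/funext => t; rewrite /expi cosN sinN mulrC /hermite_fun -/c -/(gaussian t).
  by rewrite [t * xi]mulrC; simpc; congr (_ +i* _); ring.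
rewrite cintegral_gint//; last exact: subexpZ.
rewrite gintZ// mulN1r -/(polyFT _ _) polyFT_hermite.
have s0 : (Num.sqrt (2 * pi) : R) != 0.
  by rewrite gt_eqF// sqrtr_gt0 mulr_gt0// pi_gt0.
have -> : hermite_fun n xi = (Num.sqrt (2 * pi))^-1 *
    (c * ((H n).[xi] * (Num.sqrt (2 * pi) * gaussian xi))).
  by rewrite /hermite_fun -/c -/(gaussian xi); field.
rewrite !rmorphM /=; ring.
Qed.

(** Only one integral survives: the cosine one carries an odd moment for odd k, the sine one for
    even k. This is why F_k is defined by parity. *)
Lemma Ffun_gint a k x : 0 < a ->
  (Num.sqrt (2 * pi))^-1%:C *
    (gint (fun t => `|t| `^ a * t ^+ k * cos (x * t)) +i*
     gint (fun t => `|t| `^ a * t ^+ k * sin (x * t))) = Ffun a k x.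
Proof.
move=> a0; have a0' := ltW a0.
have sq2 : Num.sqrt (2 * pi) = 2 `^ 2^-1 * Num.sqrt pi :> R.
  by rewrite sqrtrM// powR12_sqrt.
have p0 : (Num.sqrt pi : R) != 0 by rewrite gt_eqF// sqrtr_gt0 pi_gt0.
(* The factor 1/sqrt 2 from the Fourier normalization lowers the exponent of 2 by one half. *)
have pw (y z : R) : z + 2^-1 = y -> (2 `^ 2^-1)^-1 * (2 `^ y) = 2 `^ z :> R.
  have t0 : 2 `^ 2^-1 != 0 :> R by rewrite gt_eqF// powR_gt0.
  by move=> <-; rewrite powRD ?pnatr_eq0 ?implybT// mulrC mulfK.
rewrite gint_cos// gint_sin// /Ffun; simpc.
rewrite -{1 2 3 4 5}[k]odd_double_half; set m := k./2.
case: (odd k) => /=; rewrite ?add0n ?add1n.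
  rewrite (moment_odd (k := m.*2.+1)) ?mul0r ?mulr0//=; last by rewrite odd_double.
  rewrite -doubleS moment_even// odd_double /Fodd/=; simpc.
  have -> : m.+1.*2.+1 = (2 * m + 3)%N by rewrite doubleS -mul2n !addnS addn0.
  rewrite [a + _]addrC -mulNr sq2 invfM; congr (_ *i).
  rewrite -(pw (((2 * m + 3)%:R + a) / 2) (((2 * m + 2)%:R + a) / 2)); last first.
    by rewrite !natrD; field.
  by ring.
rewrite (moment_odd (k := m.*2.+1)) ?mulr0 ?mul0r ?mulr0//=; last first.
  by rewrite odd_double.
rewrite moment_even// odd_double /Feven/=.
have -> : m.*2.+1 = (2 * m + 1)%N by rewrite -mul2n addn1.
rewrite [a + _]addrC -mulNr sq2 invfM mul1r; congr (_ +i* _).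
rewrite -(pw (((2 * m + 1)%:R + a) / 2) (((2 * m)%:R + a) / 2)); last first.
  by rewrite !natrD; field.
by ring.
Qed.

End HermiteFourier.

(** * The fractional Laplacian of the normalized Hermite functions *)

Unset Implicit Arguments.

Theorem mainTheorem3 (R : realType) (alpha : R) (N : nat) (x : 'I_N -> R)
    (halpha : 0 < alpha < 2) (hN : (1 <= N)%N)
    (x_inj : injective x)
    (x_roots : forall y : R, root (hermite R N) y <-> exists j, x j = y)
    (n m : 'I_N) :
  frac_laplacian alpha (fun t => (hermite_fun n t)%:C) (x m) =
  (- 'i%C) ^+ n * \sum_(k < N) (acoef_hat R n k)%:C * Ffun alpha k (x m).
Proof.
have /andP[a0 _] := halpha; have a0' := ltW a0.
move: (x m) => y {x_inj x_roots x}.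
pose c : R := (Num.sqrt (2 ^+ n * n`!%:R))^-1.
(* With f = [cos] or [sin], these are the real and imaginary parts of |t|^alpha H_n(t) e^(iyt), and
   of the same with the monomial t^k in place of H_n. *)
pose w f t : R := `|t| `^ alpha * (hermite R n).[t] * f (y * t).
pose wk f k t : R := `|t| `^ alpha * t ^+ k * f (y * t).
have sc k : subexp (wk cos k).
  by apply: subexpM; [exact: subexp_powR_norm_exp|exact: subexp_cos].
have ss k : subexp (wk sin k).
  by apply: subexpM; [exact: subexp_powR_norm_exp|exact: subexp_sin].
have wE f : (forall k, subexp (wk f k)) -> subexp (w f) /\
    gint (w f) = \sum_(k < N) acoef R n k * gint (wk f k).
  move=> sf.
  (* As n < N, the sum reaches every coefficient of H_n; those beyond the degree are 0. *)
  have -> : w f = fun t => \sum_(k < N) acoef R n k * wk f k t.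
    apply/funext => t; rewrite /w (horner_hermite _ (ltn_ord n)).
    rewrite mulr_sumr mulr_suml; apply: eq_bigr => k _.
    by rewrite /wk; ring.
  have sk (k : 'I_N) : subexp (fun t => acoef R n k * wk f k t) by exact: subexpZ.
  split; first exact: subexp_sum.
  by rewrite gint_sum//; apply: eq_bigr => k _; rewrite gintZ.
have [swc gwc] := wE _ sc; have [sws gws] := wE _ ss.
rewrite /frac_laplacian.
have -> : (fun xi => (`|xi| `^ alpha)%:C *
    fourier (fun t => (hermite_fun n t)%:C) xi * expi (y * xi)) = fun t =>
  ((- 'i%C) ^+ n * c%:C) *
    ((w cos t * gaussian t) +i* (w sin t * gaussian t)).
  apply/funext => t; rewrite fourier_hermite_fun -!mulrA mulrCA; congr (_ * _).
  rewrite /hermite_fun /expi -/c -/(gaussian t) /w.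
  by simpc; congr (_ +i* _); ring.
rewrite cintegral_gint// gwc gws -!mulrA mulrCA; congr (_ * _).
have -> : (\sum_(k < N) acoef R n k * gint (wk cos k)) +i*
    (\sum_(k < N) acoef R n k * gint (wk sin k)) =
    \sum_(k < N) (acoef R n k)%:C * (gint (wk cos k) +i* gint (wk sin k)).
  elim/big_rec3: _ => [//|k u v z _ <-].
  by simpc.
rewrite !mulr_sumr; apply: eq_bigr => k _.
rewrite -(Ffun_gint k y a0) /acoef_hat -/c rmorphM/= -/(wk _ _ _).
ring.
Qed.
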